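(* Let $A=\sigma(R)\langle x_1,\dots,x_n\rangle$ be a bijective skew PBW extension of a ring $R$. Let $M={}_A\langle \mathbf{f}_1,\dots,\mathbf{f}_s\rangle_A$ be a finitely generated centralizing $A$-subbimodule of $A^m$, with $\mathbf{f}_i\in Cen_A(M)$ for $1\le i\le s$, and let $N={}_A\langle \mathbf{g}_1,\dots,\mathbf{g}_t\rangle$ be a finitely generated left $A$-submodule of $A^l$ ($m,l\ge 1$). Then there is an isomorphism of left $A$-modules $$M\otimes_A N\cong A^{st}/Syz(M\otimes N),$$ where $Syz(M\otimes N)\subseteq A^{st}$ is the left module of syzygies of the generators $\mathbf{f}_1\otimes\mathbf{g}_1,\dots,\mathbf{f}_1\otimes\mathbf{g}_t,\dots,\mathbf{f}_s\otimes\mathbf{g}_1,\dots,\mathbf{f}_s\otimes\mathbf{g}_t$ (in this order) of $M\otimes_A N$, and $$Syz(M\otimes N)={}_A\langle\,[\,Syz(M)\otimes I_t\mid I_s\otimes Syz(N)\,]\,\rangle,$$ i.e. $Syz(M\otimes N)$ is the left $A$-submodule of $A^{st}$ generated by the columns of the block matrix $[Syz(M)\otimes I_t\mid I_s\otimes Syz(N)]$.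
   Context: Skew PBW extension: given rings $R\subseteq A$, $A$ is a skew PBW extension of $R$, written $A=\sigma(R)\langle x_1,\dots,x_n\rangle$, if there are $x_1,\dots,x_n\in A$ such that $A$ is a free left $R$-module with basis $\{x_1^{\alpha_1}\cdots x_n^{\alpha_n}\mid \alpha\in\mathbb{N}^n\}$; for every $1\le i\le n$ and $r\in R\setminus\{0\}$ there is $c_{i,r}\in R\setminus\{0\}$ with $x_ir-c_{i,r}x_i\in R$; and for every $1\le i,j\le n$ there is $c_{i,j}\in R\setminus\{0\}$ with $x_jx_i-c_{i,j}x_ix_j\in R+Rx_1+\cdots+Rx_n$. Then for each $i$ there are an injective ring endomorphism $\sigma_i$ of $R$ and a $\sigma_i$-derivation $\delta_i$ of $R$ with $x_ir=\sigma_i(r)x_i+\delta_i(r)$ for all $r\in R$. $A$ is bijective if every $\sigma_i$ is bijective and $c_{i,j}$ is invertible for all $1\le i<j\le n$. $A$ is left Noetherian, so submodules of $A^m$ are finitely generated. $A^m$ is the free module of column vectors of length $m$. ${}_A\langle X\rangle$, $\langle X\rangle_A$, ${}_A\langle X\rangle_A$ denote the left $A$-module, right $A$-module and $A$-bimodule generated by $X$. For an $A$-bimodule $M$, $Cen_A(M)=\{\mathbf{f}\in M\mid \mathbf{f}a=a\mathbf{f}\text{ for all }a\in A\}$; $M$ is a finitely generated centralizing bimodule if it is generated (as a left, equivalently right, $A$-module) by a finite subset of $Cen_A(M)$. For elements $\mathbf{u}_1,\dots,\mathbf{u}_k$ generating a left $A$-module $L$, the left module of syzygies is $Syz(L)=\{(a_1,\dots,a_k)^T\in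 A^k\mid a_1\mathbf{u}_1+\cdots+a_k\mathbf{u}_k=0\}$ (relative to the given generators). Here $Syz(M)\subseteq A^s$ and $Syz(N)\subseteq A^t$ are taken with respect to $\mathbf{f}_1,\dots,\mathbf{f}_s$ and $\mathbf{g}_1,\dots,\mathbf{g}_t$ (with $M$ regarded as a left module). The same symbol also denotes a matrix whose columns form a finite set of left $A$-module generators of the syzygy module. For matrices, $\otimes$ is the Kronecker product: $B\otimes C$ is the block matrix with blocks $b_{ij}C$. $I_k$ is the identity matrix of size $k$. *)

(* Defs.v *)
From HB Require Import structures.
From mathcomp Require Import all_boot all_algebra.
From mathcomp Require Import generic_quotient ring_quotient boolp freeg mxtens.

Set Implicit Arguments.
Unset Strict Implicit.
Unset Printing Implicit Defensive.

Import GRing.Theory.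
Local Open Scope ring_scope.
Local Open Scope quotient_scope.

HB.mixin Record Lmodule_isBimodule (A : pzRingType) V of GRing.Lmodule A V := {
  rscale : V -> A -> V;
  rscaleA : forall v a b, rscale (rscale v a) b = rscale v (a * b);
  rscaler1 : forall v, rscale v 1 = v;
  rscaleDl : forall u v a, rscale (u + v) a = rscale u a + rscale v a;
  rscaleDr : forall v a b, rscale v (a + b) = rscale v a + rscale v b;
  rscaleAl : forall a v b, rscale (a *: v) b = a *: rscale v b
}.

#[short(type="bimodType")]
HB.structure Definition Bimodule (A : pzRingType) :=
  {V of GRing.Lmodule A V & Lmodule_isBimodule A V}.

Section MatrixBimodule.
Variables (A : pzRingType) (m n : nat).
Implicit Types (v : 'M[A]_(m, n)) (a : A).

Definition mx_rscale v a := map_mx ( *%R^~ a) v.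

Fact mx_rscaleA v a b : mx_rscale (mx_rscale v a) b = mx_rscale v (a * b).
Proof. by apply/matrixP=> i j; rewrite !mxE mulrA. Qed.
Fact mx_rscaler1 v : mx_rscale v 1 = v.
Proof. by apply/matrixP=> i j; rewrite !mxE mulr1. Qed.
Fact mx_rscaleDl u v a : mx_rscale (u + v) a = mx_rscale u a + mx_rscale v a.
Proof. by apply/matrixP=> i j; rewrite !mxE mulrDl. Qed.
Fact mx_rscaleDr v a b : mx_rscale v (a + b) = mx_rscale v a + mx_rscale v b.
Proof. by apply/matrixP=> i j; rewrite !mxE mulrDr. Qed.
Fact mx_rscaleAl a v b : mx_rscale (a *: v) b = a *: mx_rscale v b.
Proof. by apply/matrixP=> i j; rewrite !mxE mulrA. Qed.

HB.instance Definition _ := Lmodule_isBimodule.Build A 'M[A]_(m, n)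
  mx_rscaleA mx_rscaler1 mx_rscaleDl mx_rscaleDr mx_rscaleAl.
End MatrixBimodule.

HB.mixin Record isRscaleClosed (A : pzRingType) (V : bimodType A)
    (S : V -> bool) := {
  rpredZr : forall a v, v \in S -> rscale v a \in S
}.

#[short(type="subbimodClosed")]
HB.structure Definition SubbimodClosed (A : pzRingType) (V : bimodType A) :=
  {S of Algebra.isAddClosed V S & GRing.isScaleClosed A V S & isRscaleClosed A V S}.

Definition submod (A : pzRingType) (V : lmodType A) (S : submodClosed V) :=
  {v : V | v \in S}.

Section Submod.
Variables (A : pzRingType) (V : lmodType A) (S : submodClosed V).
HB.instance Definition _ := SubChoice.on (submod S).
HB.instance Definition _ := [SubChoice_isSubLmodule of submod S by <:].
End Submod.

Definition subbimod (A : pzRingType) (V : bimodType A) (S : subbimodClosed V) :=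
  {v : V | v \in S}.

Section Subbimod.
Variables (A : pzRingType) (V : bimodType A) (S : subbimodClosed V).
HB.instance Definition _ := SubChoice.on (subbimod S).
HB.instance Definition _ := [SubChoice_isSubLmodule of subbimod S by <:].

Implicit Types (v : subbimod S) (a : A).

Definition sub_rscale v a : subbimod S :=
  Sub (rscale (val v) a) (rpredZr a (val v) (valP v)).

Fact sub_rscaleA v a b : sub_rscale (sub_rscale v a) b = sub_rscale v (a * b).
Proof. by apply: val_inj; rewrite !SubK rscaleA. Qed.
Fact sub_rscaler1 v : sub_rscale v 1 = v.
Proof. by apply: val_inj; rewrite !SubK rscaler1. Qed.
Fact sub_rscaleDl u v a :
  sub_rscale (u + v) a = sub_rscale u a + sub_rscale v a.
Proof. by apply: val_inj; rewrite !(raddfD, SubK) /= rscaleDl. Qed.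
Fact sub_rscaleDr v a b :
  sub_rscale v (a + b) = sub_rscale v a + sub_rscale v b.
Proof. by apply: val_inj; rewrite !(raddfD, SubK) /= rscaleDr. Qed.
Fact sub_rscaleAl a v b : sub_rscale (a *: v) b = a *: sub_rscale v b.
Proof. by apply: val_inj; rewrite !(linearZ, SubK) /= rscaleAl. Qed.

HB.instance Definition _ := Lmodule_isBimodule.Build A (subbimod S)
  sub_rscaleA sub_rscaler1 sub_rscaleDl sub_rscaleDr sub_rscaleAl.
End Subbimod.

Section Span.
Variables (A : pzRingType) (V : lmodType A) (I : Type) (u : I -> V).

Definition lspan : {pred V} := fun v =>
  `[< forall P : {pred V},
        submod_closed P -> (forall i, u i \in P) -> v \in P >].

Lemma lspan_gen i : u i \in lspan.
Proof. exact/asboolP. Qed.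

Fact lspan_submod_closed : submod_closed lspan.
Proof.
split=> [|a v w /asboolP Lv /asboolP Lw]; apply/asboolP=> P cP Pu.
  by case: cP.
by case: (cP) => _; apply; [apply: Lv | apply: Lw].
Qed.

HB.instance Definition _ := GRing.isSubmodClosed.Build A V lspan
  (GRing.submod_closed_semi lspan_submod_closed).
End Span.

Section Bispan.
Variables (A : pzRingType) (V : bimodType A) (I : Type) (u : I -> V).

Definition bispan : {pred V} := fun v =>
  `[< forall P : {pred V}, submod_closed P ->
        (forall a w, w \in P -> rscale w a \in P) ->
        (forall i, u i \in P) -> v \in P >].

Lemma bispan_gen i : u i \in bispan.
Proof. exact/asboolP. Qed.

Fact bispan_submod_closed : submod_closed bispan.
Proof.
split=> [|a v w /asboolP Lv /asboolP Lw]; apply/asboolP=> P cP rP Pu.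
  by case: cP.
by case: (cP) => _; apply; [apply: Lv | apply: Lw].
Qed.

Fact bispan_rscale a v : v \in bispan -> rscale v a \in bispan.
Proof. by move=> /asboolP Lv; apply/asboolP=> P cP rP Pu; apply/rP/Lv. Qed.

HB.instance Definition _ := GRing.isSubmodClosed.Build A V bispan
  (GRing.submod_closed_semi bispan_submod_closed).
HB.instance Definition _ := isRscaleClosed.Build A V bispan bispan_rscale.
End Bispan.

Definition centralizer (A : pzRingType) (V : bimodType A) (S : {pred V})
    (v : V) : Prop :=
  v \in S /\ forall a : A, rscale v a = a *: v.

Definition fg_centralizing (A : pzRingType) (V : bimodType A)
    (S : subbimodClosed V) : Prop :=
  exists k (u : 'I_k -> V),
    (forall i, centralizer S (u i)) /\ S =i lspan u.

Definition left_noetherian (A : pzRingType) : Prop :=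
  forall S : submodClosed A^o, exists k (u : 'I_k -> A^o), S =i lspan u.

Definition generated_by_columns (A : pzRingType) k p (B : 'M[A]_(k, p))
    (S : {pred 'cV[A]_k}) : Prop :=
  S =i lspan (fun j => col j B).

Section QuotientModule.
Variables (A : pzRingType) (V : lmodType A) (S : submodClosed V).

Definition quotmod_pred : {pred V} := S.

Fact quotmod_pred_closed : zmod_closed quotmod_pred.
Proof. exact/GRing.subsemimod_closedB/GRing.subsemimodClosedP. Qed.

HB.instance Definition _ := GRing.isZmodClosed.Build V quotmod_pred
  quotmod_pred_closed.

Definition quotmod := Quotient.quot quotmod_pred.
HB.instance Definition _ := GRing.Zmodule.on quotmod.

Definition quotmod_class (v : V) : quotmod :=
  \pi_(Quotient.quot quotmod_pred) v.
Local Notation cl := quotmod_class.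

Lemma quotmod_ind (P : quotmod -> Prop) : (forall v, P (cl v)) -> forall x, P x.
Proof. by move=> Pcl x; rewrite -[x](reprK (_ : Quotient.quot _)). Qed.

Lemma quotmod_classP v w : cl v = cl w <-> v - w \in S.
Proof.
have -> : (v - w \in S) = (cl v == cl w :> Quotient.quot _).
  by rewrite -[LHS]/(v - w \in quotmod_pred) Quotient.idealrBE.
by split=> /eqP.
Qed.

Fact quotmod_class_is_zmod_morphism : zmod_morphism cl.
Proof. by move=> v w; rewrite /cl !piE. Qed.
HB.instance Definition _ := GRing.isZmodMorphism.Build V quotmod cl
  quotmod_class_is_zmod_morphism.

Definition quotmod_scale (a : A) (x : quotmod) : quotmod :=
  cl (a *: repr (x : Quotient.quot _)).

Lemma quotmod_scaleE a v : quotmod_scale a (cl v) = cl (a *: v).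
Proof.
apply/quotmod_classP; rewrite -scalerBr rpredZ //; apply/quotmod_classP.
by rewrite /cl reprK.
Qed.

Fact quotmod_scaleA a b x :
  quotmod_scale a (quotmod_scale b x) = quotmod_scale (a * b) x.
Proof. by elim/quotmod_ind: x => v; rewrite !quotmod_scaleE scalerA. Qed.
Fact quotmod_scale1 : left_id 1 quotmod_scale.
Proof. by elim/quotmod_ind=> v; rewrite quotmod_scaleE scale1r. Qed.
Fact quotmod_scaleDr : right_distributive quotmod_scale +%R.
Proof.
move=> a; elim/quotmod_ind=> v; elim/quotmod_ind=> w.
by rewrite -raddfD !quotmod_scaleE scalerDr raddfD.
Qed.
Fact quotmod_scaleDl x : {morph quotmod_scale^~ x : a b / a + b}.
Proof.
by elim/quotmod_ind: x => v a b /=; rewrite !quotmod_scaleE scalerDl raddfD.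
Qed.

HB.instance Definition _ := GRing.Zmodule_isLmodule.Build A quotmod
  quotmod_scaleA quotmod_scale1 quotmod_scaleDr quotmod_scaleDl.

Fact quotmod_class_is_scalable : scalable cl.
Proof. by move=> a v; rewrite -quotmod_scaleE. Qed.
HB.instance Definition _ := GRing.isScalable.Build A V quotmod *:%R cl
  quotmod_class_is_scalable.

End QuotientModule.

Section FreegAdditive.
Variables (K : choiceType).
Local Notation F := {freeg K / int}.

Lemma freeg_additive_eq (Z : zmodType) (f g : {additive F -> Z}) :
  (forall k, f << k >> = g << k >>) -> f =1 g.
Proof.
move=> fg z; rewrite -[z]freeg_sumE !raddf_sum; apply: eq_bigr => k _.
have -> : << coeff k z *g k >> = << k >> *~ coeff k z :> F.
  by rewrite freegU_mulz intz.
by rewrite !raddfMz fg.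
Qed.

Variables (Z : zmodType) (f : K -> Z).

Definition freeg_lift : F -> Z := fglift (f : K -> zmodule Z).

Fact freeg_lift_is_zmod_morphism : zmod_morphism freeg_lift.
Proof. exact: (@lift_is_additive int K (zmodule Z) f). Qed.
HB.instance Definition _ := GRing.isZmodMorphism.Build F Z freeg_lift
  freeg_lift_is_zmod_morphism.

Lemma freeg_liftU k : freeg_lift << k >> = f k.
Proof. by rewrite /freeg_lift liftU scale1r. Qed.
End FreegAdditive.

Section Tensor.
Variables (A : pzRingType) (M : bimodType A) (N : lmodType A).
Implicit Types (m : M) (n : N) (a : A).
Local Notation F := {freeg (M * N)%type / int}.

Inductive tensor_rel : F -> Prop :=
| Tensor_Dl m1 m2 n :
    tensor_rel (<< (m1 + m2, n) >> - << (m1, n) >> - << (m2, n) >>)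
| Tensor_Dr m n1 n2 :
    tensor_rel (<< (m, n1 + n2) >> - << (m, n1) >> - << (m, n2) >>)
| Tensor_A m a n :
    tensor_rel (<< (rscale m a, n) >> - << (m, a *: n) >>).

Definition tensor_span : {pred F} := fun z =>
  `[< forall P : {pred F},
        zmod_closed P -> (forall x, tensor_rel x -> x \in P) -> z \in P >].

Fact tensor_span_closed : zmod_closed tensor_span.
Proof.
split=> [|x y /asboolP Tx /asboolP Ty]; apply/asboolP=> P cP relP.
  by case: cP.
by case: (cP) => _; apply; [apply: Tx | apply: Ty].
Qed.

HB.instance Definition _ := GRing.isZmodClosed.Build F tensor_span
  tensor_span_closed.

Definition tensor := Quotient.quot tensor_span.
HB.instance Definition _ := GRing.Zmodule.on tensor.

Definition tensor_class (z : F) : tensor := \pi_(Quotient.quot tensor_span) z.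
Local Notation cl := tensor_class.

Definition tens m n : tensor := cl << (m, n) >>.

Lemma tensor_class_ind (P : tensor -> Prop) :
  (forall z, P (cl z)) -> forall t, P t.
Proof. by move=> Pcl x; rewrite -[x](reprK (_ : Quotient.quot _)). Qed.

Lemma tensor_classP y z : cl y = cl z <-> y - z \in tensor_span.
Proof.
have -> : (y - z \in tensor_span) = (cl y == cl z :> Quotient.quot _).
  by rewrite Quotient.idealrBE.
by split=> /eqP.
Qed.

Fact tensor_class_is_zmod_morphism : zmod_morphism cl.
Proof. by move=> v w; rewrite /cl !piE. Qed.
HB.instance Definition _ := GRing.isZmodMorphism.Build F tensor cl
  tensor_class_is_zmod_morphism.

Lemma tensor_class_rel x : tensor_rel x -> cl x = 0.
Proof.
move=> relx; rewrite -(raddf0 cl); apply/tensor_classP.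
by rewrite subr0; apply/asboolP=> P _; apply.
Qed.

Lemma tensDl m1 m2 n : tens (m1 + m2) n = tens m1 n + tens m2 n.
Proof.
have /eqP := tensor_class_rel (Tensor_Dl m1 m2 n).
by rewrite !raddfB subr_eq0 subr_eq => /eqP rel; rewrite [RHS]addrC.
Qed.

Lemma tensDr m n1 n2 : tens m (n1 + n2) = tens m n1 + tens m n2.
Proof.
have /eqP := tensor_class_rel (Tensor_Dr m n1 n2).
by rewrite !raddfB subr_eq0 subr_eq => /eqP rel; rewrite [RHS]addrC.
Qed.

Lemma tensA m a n : tens (rscale m a) n = tens m (a *: n).
Proof.
have /eqP := tensor_class_rel (Tensor_A m a n).
by rewrite raddfB subr_eq0 => /eqP.
Qed.

Lemma tensor_additive_eq (Z : zmodType) (f g : {additive tensor -> Z}) :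
  (forall m n, f (tens m n) = g (tens m n)) -> f =1 g.
Proof.
move=> fg; elim/tensor_class_ind=> z.
rewrite -[LHS]/((f \o cl) z) -[RHS]/((g \o cl) z).
by apply: freeg_additive_eq => -[m n]; apply: fg.
Qed.

Section Lift.
Variables (Z : zmodType) (beta : M -> N -> Z).
Hypothesis betaDl : forall m1 m2 n, beta (m1 + m2) n = beta m1 n + beta m2 n.
Hypothesis betaDr : forall m n1 n2, beta m (n1 + n2) = beta m n1 + beta m n2.
Hypothesis betaA : forall m a n, beta (rscale m a) n = beta m (a *: n).

Local Notation bl := (freeg_lift (fun p => beta p.1 p.2)).

Definition tensor_lift (t : tensor) : Z :=
  bl (repr (t : Quotient.quot tensor_span)).

Fact tensor_lift_class z : tensor_lift (cl z) = bl z.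
Proof.
apply/eqP; rewrite -subr_eq0 -raddfB.
have: repr (cl z : Quotient.quot tensor_span) - z \in tensor_span.
  by apply/tensor_classP; rewrite /cl reprK.
move/asboolP/(_ [pred x | bl x == 0]); apply.
  split=> [|x y]; rewrite !inE ?raddf0 // => /eqP bx /eqP b_y.
  by rewrite raddfB /= bx b_y subr0.
move=> _ [m1 m2 n|m n1 n2|m a n]; rewrite inE !raddfB /= !freeg_liftU /=.
- by rewrite betaDl addrAC addrK subrr.
- by rewrite betaDr addrAC addrK subrr.
- by rewrite betaA subrr.
Qed.

Fact tensor_lift_is_zmod_morphism : zmod_morphism tensor_lift.
Proof.
elim/tensor_class_ind=> x; elim/tensor_class_ind=> y.
by rewrite -raddfB !tensor_lift_class raddfB.
Qed.
HB.instance Definition _ := GRing.isZmodMorphism.Build tensor Z tensor_lift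
  tensor_lift_is_zmod_morphism.

Lemma tensor_lift_tens m n : tensor_lift (tens m n) = beta m n.
Proof. by rewrite tensor_lift_class freeg_liftU. Qed.
End Lift.

Section Scale.
Variable a : A.
Local Notation beta := (fun m n => tens (a *: m) n).

Fact tensor_scale_Dl m1 m2 n : beta (m1 + m2) n = beta m1 n + beta m2 n.
Proof. by rewrite /= scalerDr tensDl. Qed.
Fact tensor_scale_Dr m n1 n2 : beta m (n1 + n2) = beta m n1 + beta m n2.
Proof. exact: tensDr. Qed.
Fact tensor_scale_A m b n : beta (rscale m b) n = beta m (b *: n).
Proof. by rewrite /= -rscaleAl tensA. Qed.

Definition tensor_scale : tensor -> tensor := tensor_lift beta.
HB.instance Definition _ := GRing.isZmodMorphism.Build tensor tensor tensor_scale
  (tensor_lift_is_zmod_morphism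
     tensor_scale_Dl tensor_scale_Dr tensor_scale_A).

Lemma tensor_scaleE m n : tensor_scale (tens m n) = tens (a *: m) n.
Proof.
exact: (tensor_lift_tens tensor_scale_Dl tensor_scale_Dr tensor_scale_A).
Qed.
End Scale.

Fact tensor_scaleA a b t :
  tensor_scale a (tensor_scale b t) = tensor_scale (a * b) t.
Proof.
apply: (tensor_additive_eq (f := tensor_scale a \o tensor_scale b)) => m n /=.
by rewrite !tensor_scaleE scalerA.
Qed.
Fact tensor_scale1 : left_id 1 tensor_scale.
Proof.
apply: (tensor_additive_eq (g := idfun)) => m n /=.
by rewrite tensor_scaleE scale1r.
Qed.
Fact tensor_scaleDr : right_distributive tensor_scale +%R.
Proof. by move=> a t u; rewrite raddfD. Qed.
Fact tensor_scaleDl t : {morph tensor_scale^~ t : a b / a + b}.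
Proof.
move=> a b /=; apply: (tensor_additive_eq
  (g := tensor_scale a \+ tensor_scale b)) => m n /=.
by rewrite !tensor_scaleE scalerDl tensDl.
Qed.

HB.instance Definition _ := GRing.Zmodule_isLmodule.Build A tensor
  tensor_scaleA tensor_scale1 tensor_scaleDr tensor_scaleDl.

Lemma tensZl a m n : a *: tens m n = tens (a *: m) n.
Proof. exact: tensor_scaleE. Qed.

End Tensor.

Section Syzygies.
Variables (A : pzRingType) (V : lmodType A) (k : nat) (u : 'I_k -> V).

Definition syz : {pred 'cV[A]_k} := fun a => \sum_i a i 0 *: u i == 0.

Fact syz_submod_closed : submod_closed syz.
Proof.
split=> [|a v w /eqP Sv /eqP Sw]; apply/eqP.
  by apply: big1 => i _; rewrite mxE scale0r.
transitivity (a *: (\sum_i v i 0 *: u i) + \sum_i w i 0 *: u i).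
  rewrite scaler_sumr -big_split; apply: eq_bigr => i _.
  by rewrite !mxE scalerDl scalerA.
by rewrite Sv Sw scaler0 addr0.
Qed.

HB.instance Definition _ := GRing.isSubmodClosed.Build A 'cV[A]_k syz
  (GRing.submod_closed_semi syz_submod_closed).
End Syzygies.

Definition lspan_elt (A : pzRingType) (V : lmodType A) (I : Type) (u : I -> V)
    (i : I) : submod (lspan u) :=
  Sub (u i) (lspan_gen u i).

Definition bispan_elt (A : pzRingType) (V : bimodType A) (I : Type)
    (u : I -> V) (i : I) : subbimod (bispan u) :=
  Sub (u i) (bispan_gen u i).

(* [mxtens_unindex] enumerates the pairs in lexicographic order, the order
   used by the Kronecker product [*t]. *)
Definition tensor_gens (A : pzRingType) (U : bimodType A) (V : lmodType A) s t
    (f : 'I_s -> U) (g : 'I_t -> V) (k : 'I_(s * t)) :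
    tensor (subbimod (bispan f)) (submod (lspan g)) :=
  tens (bispan_elt f (mxtens_unindex k).1) (lspan_elt g (mxtens_unindex k).2).

Section SkewPBW.
Variables (R A : pzRingType) (iota : {rmorphism R -> A}).

Definition left_basis (I : eqType) (b : I -> A) : Prop :=
  (forall a : A, exists2 s : seq I, uniq s &
     exists c : I -> R, a = \sum_(i <- s) iota (c i) * b i) /\
  (forall (s : seq I) (c : I -> R), uniq s ->
     \sum_(i <- s) iota (c i) * b i = 0 -> {in s, forall i, c i = 0}).

Variables (n : nat) (x : 'I_n -> A).

Definition std_monomial (alpha : {ffun 'I_n -> nat}) : A :=
  \prod_(i < n) x i ^+ alpha i.

Definition var_commutation (i j : 'I_n) (c : R) : Prop :=
  exists (d0 : R) (d : 'I_n -> R),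
    x j * x i - iota c * (x i * x j) = iota d0 + \sum_k iota (d k) * x k.

(* [A] is a skew PBW extension of the subring [iota R]. *)
Record skew_PBW : Prop := {
  spbw_inj : injective iota;
  spbw_basis : left_basis std_monomial;
  spbw_coef : forall i r, r != 0 -> exists2 c, c != 0 &
    exists d, x i * iota r - iota c * x i = iota d;
  spbw_var : forall i j, exists2 c, c != 0 & var_commutation i j c
}.

Definition skew_derivation (sigma : {rmorphism R -> R}) (delta : R -> R) :
    Prop :=
  (forall r s, delta (r + s) = delta r + delta s) /\
  (forall r s, delta (r * s) = sigma r * delta s + delta r * s).

(* By freeness, [sigma] and [delta] are determined by [x i], and so is
   [c] by [i < j]: the existential quantifiers pick out the only candidates. *)
Record bijective_skew_PBW : Prop := {
  bspbw_skew_PBW : skew_PBW;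
  bspbw_sigma : forall i, exists (sigma : {rmorphism R -> R}) (delta : R -> R),
    [/\ skew_derivation sigma delta,
        forall r, x i * iota r = iota (sigma r) * x i + iota (delta r) &
        bijective sigma];
  bspbw_unit : forall i j : 'I_n, (i < j)%N -> exists c,
    [/\ c != 0, var_commutation i j c & exists c', c' * c = 1 /\ c * c' = 1]
}.

End SkewPBW.

(* Main.v *)
(* Since the [f i] are central, [syz f] is stable under right multiplication,
   and a tensor of the combinations of [f] and [g] with coefficients [a] and
   [b] has coefficients [a_i * b_j] on the generators [f_i (x) g_j].  Modulo
   the span [W] of the block columns, [a_i * b_j] vanishes as soon as [a] or
   [b] is a syzygy; hence it defines a balanced map from [M * N] to
   [A^(st) / W], and the induced map on the tensor product shows that every
   syzygy of the [f_i (x) g_j] lies in [W]. *)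
Require Import Defs.
From HB Require Import structures.
From mathcomp Require Import all_boot all_algebra.
From mathcomp Require Import boolp freeg mxtens.

Set Implicit Arguments.
Unset Strict Implicit.
Unset Printing Implicit Defensive.

Import GRing.Theory.
Local Open Scope ring_scope.

(** * Linear combinations with coefficient columns *)

Definition lincomb (A : pzRingType) (V : lmodType A) k (u : 'I_k -> V)
    (a : 'cV[A]_k) : V :=
  \sum_i a i 0 *: u i.

Fact lincomb_is_linear (A : pzRingType) (V : lmodType A) k (u : 'I_k -> V) :
  linear (lincomb u).
Proof.
move=> c a b; rewrite /lincomb scaler_sumr -big_split; apply: eq_bigr => i _.
by rewrite !mxE scalerDl scalerA.
Qed.

HB.instance Definition _ (A : pzRingType) (V : lmodType A) k (u : 'I_k -> V) :=
  GRing.isLinear.Build A 'cV[A]_k V *:%R (lincomb u) (lincomb_is_linear u).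

Section Combinations.
Variables (A : pzRingType) (V : lmodType A) (k : nat) (u : 'I_k -> V).

Lemma mem_syz a : (a \in syz u) = (lincomb u a == 0).
Proof. by []. Qed.

Lemma lincomb_delta i : lincomb u (delta_mx i 0) = u i.
Proof.
rewrite /lincomb (bigD1 i) //= mxE !eqxx scale1r big1 ?addr0 // => j ji.
by rewrite mxE (negPf ji) scale0r.
Qed.

Lemma lincomb_lspan a : lincomb u a \in lspan u.
Proof. by apply: rpred_sum => i _; apply/rpredZ/lspan_gen. Qed.

Lemma lspanP v : v \in lspan u -> exists a, lincomb u a = v.
Proof.
(* The combinations already form a submodule containing every [u i]. *)
move/asboolP/(_ (fun w => `[< exists a, lincomb u a = w >])) => spanv.
apply/asboolP/spanv => [|i].
  split=> [|c _ _ /asboolP[a <-] /asboolP[b <-]]; apply/asboolP.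
    by exists 0; rewrite raddf0.
  by exists (c *: a + b); rewrite linearP.
by apply/asboolP; exists (delta_mx i 0); rewrite lincomb_delta.
Qed.

Lemma lspan_sub (W : submodClosed V) :
  (forall i, u i \in W) -> {subset lspan u <= W}.
Proof. by move=> uW _ /lspanP[a <-]; apply: rpred_sum => i _; apply: rpredZ. Qed.

(** First isomorphism theorem: two coefficient columns give the same vector exactly when they differ
    by a syzygy. *)
Lemma syz_presentation : (forall v, v \in lspan u) ->
  exists phi : {linear V -> quotmod (syz u)}, bijective phi.
Proof.
move=> spanV; pose coef v := sval (cid (lspanP (spanV v))).
have coefK v : lincomb u (coef v) = v by rewrite /coef; case: cid.
pose cl := quotmod_class (syz u).
have clP a b : cl a = cl b <-> lincomb u a = lincomb u b.
  rewrite quotmod_classP mem_syz raddfB subr_eq0 /=.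
  by split=> [/eqP|->].
(* The choice [coef] need not be linear, but its class modulo [syz u] is, since that class depends
   only on the combination. *)
have lin : linear (fun v => cl (coef v)).
  move=> c v w; rewrite -linearP; apply/clP.
  by rewrite coefK linearP /= !coefK.
pose phi : {linear V -> quotmod (syz u)} :=
  HB.pack (fun v => cl (coef v)) (GRing.isLinear.Build _ _ _ _ _ lin).
exists phi.
have psiP x : exists v, phi v = x.
  by elim/quotmod_ind: x => a; exists (lincomb u a); apply/clP; rewrite coefK.
exists (fun x => sval (cid (psiP x))) => [v|x]; last by case: cid.
by case: cid => w /= /clP; rewrite !coefK.
Qed.
End Combinations.

Lemma rpred_lincomb (A : pzRingType) (V : lmodType A) (W : submodClosed V) k
    (u : 'I_k -> V) a :
  (forall i, u i \in W) -> lincomb u a \in W.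
Proof. by move=> uW; apply: rpred_sum => i _; apply: rpredZ. Qed.

Lemma linear_lincomb (A : pzRingType) (U V : lmodType A) (h : {linear U -> V}) k
    (u : 'I_k -> U) a :
  h (lincomb u a) = lincomb (h \o u) a.
Proof. by rewrite linear_sum; apply: eq_bigr => i _; rewrite linearZ. Qed.

Lemma rscale0l (A : pzRingType) (U : bimodType A) c : rscale (0 : U) c = 0.
Proof. by rewrite -[X in rscale X](scale0r 0) rscaleAl scale0r. Qed.

(** Centrality lets [c] pass through the generators: [a_i u_i c = a_i c u_i]. *)
Lemma rscale_lincomb (A : pzRingType) (U : bimodType A) k (u : 'I_k -> U) a c :
  (forall i b, rscale (u i) b = b *: u i) ->
  rscale (lincomb u a) c = lincomb u (rscale a c).
Proof.
move=> cent_u.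
rewrite /lincomb (big_morph (rscale^~ c) (fun v w => rscaleDl v w c) (rscale0l _ c)).
by apply: eq_bigr => i _; rewrite rscaleAl cent_u scalerA mxE.
Qed.

Lemma col_sum_delta (A : pzRingType) k (v : 'cV[A]_k) :
  v = \sum_i v i 0 *: delta_mx i 0.
Proof. by rewrite [LHS]matrix_sum_delta; apply: eq_bigr => i _; rewrite big_ord1. Qed.

(** * Kronecker products of columns over a ring that need not be commutative *)

Section Kronecker.
Variables (A : pzRingType) (s t : nat).
Implicit Types (a : 'cV[A]_s) (b : 'cV[A]_t).

(** The order of the factors makes this left linear in [a] and balanced, but in general not left
    linear in [b]. *)
Definition kron a b : 'cV[A]_(s * t) :=
  \col_k (a (mxtens_unindex k).1 0 * b (mxtens_unindex k).2 0).

Lemma kronDl a1 a2 b : kron (a1 + a2) b = kron a1 b + kron a2 b.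
Proof. by apply/colP=> k; rewrite !mxE mulrDl. Qed.

Lemma kronDr a b1 b2 : kron a (b1 + b2) = kron a b1 + kron a b2.
Proof. by apply/colP=> k; rewrite !mxE mulrDr. Qed.

Lemma kronBl a1 a2 b : kron (a1 - a2) b = kron a1 b - kron a2 b.
Proof. by apply/colP=> k; rewrite !mxE mulrBl. Qed.

Lemma kronBr a b1 b2 : kron a (b1 - b2) = kron a b1 - kron a b2.
Proof. by apply/colP=> k; rewrite !mxE mulrBr. Qed.

Lemma kronZl c a b : kron (c *: a) b = c *: kron a b.
Proof. by apply/colP=> k; rewrite !mxE mulrA. Qed.

Lemma kron_rscale a c b : kron (rscale a c) b = kron a (c *: b).
Proof. by apply/colP=> k; rewrite !mxE mulrA. Qed.

(** Each [b_j] stands to the right of the entries of [a], so it is absorbed into [a] by right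
    scaling instead of being pulled out as a left scalar. *)
Lemma kron_sumr a b :
  kron a b = \sum_j kron (rscale a (b j 0)) (delta_mx j 0).
Proof.
apply/colP=> k; rewrite summxE mxE (bigD1 (mxtens_unindex k).2) //=.
rewrite !mxE !eqxx mulr1 big1 ?addr0 // => j jk.
by rewrite !mxE eq_sym (negPf jk) mulr0.
Qed.

Lemma kron_suml a b :
  kron a b = \sum_i a i 0 *: kron (delta_mx i 0) b.
Proof.
apply/colP=> k; rewrite summxE mxE (bigD1 (mxtens_unindex k).1) //=.
rewrite !mxE !eqxx mul1r big1 ?addr0 // => i ik.
by rewrite !mxE eq_sym (negPf ik) mul0r mulr0.
Qed.

Lemma kron_delta k :
  kron (delta_mx (mxtens_unindex k).1 0) (delta_mx (mxtens_unindex k).2 0)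
  = delta_mx k 0.
Proof.
apply/colP=> k'; rewrite !mxE !eqxx !andbT -natrM mulnb.
(* The product of the two indicators tests equality of the index pairs, and unindexing is
   injective. *)
congr (nat_of_bool _)%:R; rewrite -xpair_eqE -!surjective_pairing.
exact/inj_eq/(can_inj (@mxtens_unindexK s t)).
Qed.

Lemma col_tensmx p q (B : 'M[A]_(s, p)) (C : 'M[A]_(t, q)) j :
  col j (tensmx B C) =
  kron (col (mxtens_unindex j).1 B) (col (mxtens_unindex j).2 C).
Proof. by apply/colP=> k; rewrite !mxE. Qed.

Lemma kron_lincombl k (u : 'I_k -> 'cV[A]_s) c b :
  kron (lincomb u c) b = lincomb (fun i => kron (u i) b) c.
Proof.
apply/colP=> h; rewrite mxE !summxE mulr_suml.
by apply: eq_bigr => i _; rewrite !mxE mulrA.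
Qed.

(** The left factor is a unit column because its entries 0 and 1 commute with the coefficients [c];
    those of an arbitrary column need not. *)
Lemma kron_delta_lincombr i k (u : 'I_k -> 'cV[A]_t) c :
  kron (delta_mx i 0) (lincomb u c) =
  lincomb (fun j => kron (delta_mx i 0) (u j)) c.
Proof.
apply/colP=> h; rewrite mxE !summxE mulr_sumr.
apply: eq_bigr => j _; rewrite !mxE eqxx andbT.
by case: eqP => _; rewrite ?mul1r // !mul0r mulr0.
Qed.
End Kronecker.

(** * Syzygies of the tensors of two generating families *)

Section TensorGenerators.
Variables (A : pzRingType) (M : bimodType A) (N : lmodType A) (s t : nat).
Variables (F : 'I_s -> M) (G : 'I_t -> N).
Hypothesis centF : forall i a, rscale (F i) a = a *: F i.
Hypothesis spanF : forall x, x \in lspan F.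
Hypothesis spanG : forall y, y \in lspan G.

(** Abstract form of [tensor_gens f g], which is the case of [bispan_elt f] and [lspan_elt g]. *)
Definition gens_tens (k : 'I_(s * t)) : tensor M N :=
  tens (F (mxtens_unindex k).1) (G (mxtens_unindex k).2).

Lemma tens0l (y : N) : tens (0 : M) y = 0.
Proof. by rewrite -(scale0r 0) -tensZl scale0r. Qed.

Lemma tens0r (x : M) : tens x (0 : N) = 0.
Proof. by apply: (addrI (tens x 0)); rewrite -tensDr !addr0. Qed.

Lemma tens_suml I r (P : pred I) (h : I -> M) (y : N) :
  tens (\sum_(i <- r | P i) h i) y = \sum_(i <- r | P i) tens (h i) y.
Proof.
by apply: (big_morph (fun x => tens x y)) => [? ?|]; rewrite ?tensDl ?tens0l.
Qed.

Lemma tens_sumr I r (P : pred I) (x : M) (h : I -> N) :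
  tens x (\sum_(i <- r | P i) h i) = \sum_(i <- r | P i) tens x (h i).
Proof. by apply: big_morph => [? ?|]; rewrite ?tensDr ?tens0r. Qed.

(** [b_j] crosses the tensor sign to the right of [F_i], then passes to its left by centrality and
    joins [a_i]. *)
Lemma tens_lincomb a b :
  tens (lincomb F a) (lincomb G b) = lincomb gens_tens (kron a b).
Proof.
rewrite /lincomb tens_suml.
transitivity (\sum_i \sum_j (a i 0 * b j 0) *: tens (F i) (G j)).
  apply: eq_bigr => i _; rewrite tens_sumr; apply: eq_bigr => j _.
  by rewrite -tensA rscaleAl centF scalerA tensZl.
rewrite pair_big (reindex (@mxtens_unindex s t)) /=; last first.
  exists (@mxtens_index s t) => k _; first exact: mxtens_unindexK.
  exact: mxtens_indexK.
by apply: eq_bigr => k _; rewrite mxE.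
Qed.

Lemma gens_tens_span z : z \in lspan gens_tens.
Proof.
elim/tensor_class_ind: z => z.
(* A tensor is an integer combination of pure tensors, so only these need checking. *)
rewrite -[z]freeg_sumE raddf_sum; apply: rpred_sum => -[x y] _.
rewrite -[coeff _ _]intz -freegU_mulz raddfMz rpredMz //.
have [[a <-] [b <-]] := (lspanP (spanF x), lspanP (spanG y)).
by rewrite -[X in X \in _]/(tens _ _) tens_lincomb lincomb_lspan.
Qed.

Lemma kron_syzl a b : a \in syz F -> kron a b \in syz gens_tens.
Proof. by rewrite !mem_syz -tens_lincomb => /eqP->; rewrite tens0l. Qed.

Lemma kron_syzr a b : b \in syz G -> kron a b \in syz gens_tens.
Proof. by rewrite !mem_syz -tens_lincomb => /eqP->; rewrite tens0r. Qed.

Lemma syz_gens_tens_sub (W : submodClosed 'cV[A]_(s * t)) :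
  (forall a b, a \in syz F -> kron a b \in W) ->
  (forall a b, b \in syz G -> kron a b \in W) ->
  {subset syz gens_tens <= W}.
Proof.
move=> synF synG.
pose cF x := sval (cid (lspanP (spanF x))).
pose cG y := sval (cid (lspanP (spanG y))).
have cFK x : lincomb F (cF x) = x by rewrite /cF; case: cid.
have cGK y : lincomb G (cG y) = y by rewrite /cG; case: cid.
pose beta x y := quotmod_class W (kron (cF x) (cG y)).
(* Independence of the chosen coefficients: the difference is [kron (cF x - a) (cG y) + kron a (cG y
   - b)], with a syzygy as one factor of each term. *)
have betaE x y a b : lincomb F a = x -> lincomb G b = y ->
    beta x y = quotmod_class W (kron a b).
  move=> Fa Gb; apply/quotmod_classP.
  rewrite -(subrK (kron a (cG y)) (kron (cF x) _)) -addrA -kronBl -kronBr.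
  apply: rpredD; [apply: synF | apply: synG]; rewrite mem_syz raddfB /=.
    by rewrite cFK Fa subrr.
  by rewrite cGK Gb subrr.
have betaDl x1 x2 y : beta (x1 + x2) y = beta x1 y + beta x2 y.
  by rewrite -raddfD -kronDl; apply: betaE; rewrite ?raddfD /= ?cFK.
have betaDr x y1 y2 : beta x (y1 + y2) = beta x y1 + beta x y2.
  by rewrite -raddfD -kronDr; apply: betaE; rewrite ?raddfD /= ?cGK.
have betaA x c y : beta (rscale x c) y = beta x (c *: y).
  rewrite (betaE (rscale x c) y (rscale (cF x) c) (cG y)) ?cGK //.
    by rewrite kron_rscale; apply/esym/betaE; rewrite // linearZ /= cGK.
  by rewrite -rscale_lincomb // cFK.
have [lift liftT] : exists h : {additive tensor M N -> quotmod W},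
    forall x y, h (tens x y) = beta x y.
  have := tensor_lift_tens betaDl betaDr betaA.
  have := tensor_lift_is_zmod_morphism betaDl betaDr betaA.
  move: (tensor_lift beta) => h hB hT.
  pose lift : {additive tensor M N -> quotmod W} :=
    HB.pack h (GRing.isZmodMorphism.Build _ _ _ hB).
  by exists lift.
(* [lift] is only known to be additive, so each scalar [v_k] is moved into the first tensor factor
   before evaluating. *)
have liftE v : lift (lincomb gens_tens v) = quotmod_class W v.
  rewrite raddf_sum [v in RHS]col_sum_delta raddf_sum; apply: eq_bigr => k _.
  rewrite /= tensZl liftT -kron_delta -kronZl; apply: betaE.
    by rewrite linearZ /= lincomb_delta.
  by rewrite lincomb_delta.
move=> v; rewrite mem_syz => /eqP v0.
rewrite -[v]subr0; apply/quotmod_classP.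
by rewrite -liftE v0 !raddf0.
Qed.
End TensorGenerators.

(** * Subbimodules with central generators *)

Section CentralGenerators.
Variables (A : pzRingType) (U : bimodType A) (s : nat) (f : 'I_s -> U).
Hypothesis centf : forall i, centralizer (bispan f) (f i).

Lemma bispan_elt_central i a : rscale (bispan_elt f i) a = a *: bispan_elt f i.
Proof. by apply: val_inj; rewrite linearZ; apply: (centf i).2. Qed.

(** With central generators the left span is stable under right multiplication, hence already a
    subbimodule. *)
Lemma bispan_sub_lspan : {subset bispan f <= lspan f}.
Proof.
move=> v /asboolP; apply; [exact: lspan_submod_closed | | exact: lspan_gen].
move=> a _ /lspanP[c <-]; rewrite rscale_lincomb ?lincomb_lspan // => i b.
exact: (centf i).2.
Qed.

Lemma bispan_elt_span x : x \in lspan (bispan_elt f).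
Proof.
have /lspanP[a fa] := bispan_sub_lspan (valP x).
suff -> : x = lincomb (bispan_elt f) a by apply: lincomb_lspan.
by apply: val_inj; rewrite linear_lincomb.
Qed.
End CentralGenerators.

Lemma lspan_elt_span (A : pzRingType) (V : lmodType A) k (g : 'I_k -> V) y :
  y \in lspan (lspan_elt g).
Proof.
have /lspanP[a ga] := valP y.
suff -> : y = lincomb (lspan_elt g) a by apply: lincomb_lspan.
by apply: val_inj; rewrite linear_lincomb.
Qed.

(** Lets syzygies be taken in the ambient free modules, although the tensor product is built on
    submodules. *)
Lemma syz_inj (A : pzRingType) (U V : lmodType A) (h : {linear U -> V}) k
    (u : 'I_k -> U) :
  injective h -> syz (h \o u) =i syz u.
Proof.
by move=> h_inj a; rewrite !mem_syz -linear_lincomb; apply: raddf_eq0.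
Qed.

(** * Span of the columns of the block matrix *)

Section KroneckerColumns.
Variables (A : pzRingType) (s t p q : nat).
Variables (SM : 'M[A]_(s, p)) (SN : 'M[A]_(t, q)).
Local Notation B := (row_mx (tensmx SM (1%:M : 'M_t)) (tensmx (1%:M : 'M_s) SN)).

Lemma col_scalar1 k (j : 'I_k) : col j (1%:M : 'M[A]_k) = delta_mx j 0.
Proof. by apply/colP=> i; rewrite !mxE eqxx andbT. Qed.

Lemma col_block_tens_l i j :
  kron (col i SM) (delta_mx j 0) = col (lshift _ (mxtens_index (i, j))) B.
Proof. by rewrite colKl col_tensmx mxtens_indexK col_scalar1. Qed.

Lemma col_block_tens_r i j :
  kron (delta_mx i 0) (col j SN) = col (rshift _ (mxtens_index (i, j))) B.
Proof. by rewrite colKr col_tensmx mxtens_indexK col_scalar1. Qed.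

Lemma lspan_block_tens_sub (W : submodClosed 'cV[A]_(s * t)) :
  (forall i b, kron (col i SM) b \in W) ->
  (forall a j, kron a (col j SN) \in W) ->
  {subset lspan (fun k => col k B) <= W}.
Proof.
move=> WM WN; apply: lspan_sub => k; case: (splitP k) => h kh.
  have -> : k = lshift _ h by apply: val_inj.
  by rewrite colKl col_tensmx.
have -> : k = rshift _ h by apply: val_inj.
by rewrite colKr col_tensmx.
Qed.

(** All right multiples of [a] are required because [kron_sumr] produces the columns
    [rscale a (b j 0)]. *)
Lemma kron_lspan_l a b : (forall c, rscale a c \in lspan (fun i => col i SM)) ->
  kron a b \in lspan (fun k => col k B).
Proof.
move=> aSM; rewrite kron_sumr; apply: rpred_sum => j _.
have /lspanP[c <-] := aSM (b j 0).
rewrite kron_lincombl; apply: rpred_lincomb => i.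
by rewrite col_block_tens_l; apply: (lspan_gen (fun k => col k B)).
Qed.

(** Expanding [a] first leaves unit columns on the left, where [kron_delta_lincombr] applies. *)
Lemma kron_lspan_r a b : b \in lspan (fun j => col j SN) ->
  kron a b \in lspan (fun k => col k B).
Proof.
move=> /lspanP[c <-]; rewrite kron_suml; apply: rpred_sum => i _.
apply: rpredZ; rewrite kron_delta_lincombr; apply: rpred_lincomb => j.
by rewrite col_block_tens_r; apply: (lspan_gen (fun k => col k B)).
Qed.
End KroneckerColumns.

Lemma syz_rscale (A : pzRingType) (U : bimodType A) k (u : 'I_k -> U) a c :
  (forall i b, rscale (u i) b = b *: u i) ->
  a \in syz u -> rscale a c \in syz u.
Proof.
move=> cent_u; rewrite !mem_syz -rscale_lincomb // => /eqP->.
by rewrite rscale0l.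
Qed.

Theorem theorem12 (R A : pzRingType) (iota : {rmorphism R -> A})
  (n : nat) (x : 'I_n -> A)
  (bijA : bijective_skew_PBW iota x) (noethA : left_noetherian A)
  (m l s t : nat) (m_gt0 : (0 < m)%N) (l_gt0 : (0 < l)%N)
  (f : 'I_s -> 'cV[A]_m) (g : 'I_t -> 'cV[A]_l)
  (centM : fg_centralizing (bispan f))
  (cent_f : forall i, centralizer (bispan f) (f i)) :
  [/\
      exists phi : {linear tensor (subbimod (bispan f)) (submod (lspan g)) ->
                           quotmod (syz (tensor_gens f g))},
        bijective phi,
      forall z : tensor (subbimod (bispan f)) (submod (lspan g)),
        z \in lspan (tensor_gens f g) &
      forall (p q : nat) (SM : 'M[A]_(s, p)) (SN : 'M[A]_(t, q)),
        generated_by_columns SM (syz f) ->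
        generated_by_columns SN (syz g) ->
        generated_by_columns
          (row_mx (tensmx SM (1%:M : 'M[A]_t)) (tensmx (1%:M : 'M[A]_s) SN))
          (syz (tensor_gens f g))].
Proof.
pose F := bispan_elt f; pose G := lspan_elt g.
have centF : forall i a, rscale (F i) a = a *: F i := bispan_elt_central cent_f.
have spanF : forall y, y \in lspan F := bispan_elt_span cent_f.
have spanG : forall y, y \in lspan G := lspan_elt_span (g := g).
have span_tens : forall z, z \in lspan (tensor_gens f g).
  exact: gens_tens_span centF spanF spanG.
split=> [|//|p q SM SN genSM genSN v]; first exact: syz_presentation.
have synF : syz f =i syz F by apply: (syz_inj F val_inj).
have synG : syz g =i syz G by apply: (syz_inj G val_inj).
apply/idP/idP; last first.
  (* Each block column is a Kronecker product with a syzygy as one factor. *)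
  apply: lspan_block_tens_sub => [i b|a j].
    apply: (kron_syzl G centF); rewrite -synF genSM.
    exact: (lspan_gen (fun i => col i SM)).
  apply: (kron_syzr centF); rewrite -synG genSN.
  exact: (lspan_gen (fun j => col j SN)).
apply: (syz_gens_tens_sub centF spanF spanG) => a b.
  (* Centrality makes [syz F] stable under right multiplication, so every right multiple of [a] is a
     combination of columns of [SM]. *)
  move=> synFa; apply: kron_lspan_l => c.
  by rewrite -genSM synF syz_rscale.
by rewrite -synG genSN; apply: kron_lspan_r.
Qed.
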